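(* Let $\varphi$ be a complete Bernstein function of the form $\varphi(x)=\int_0^\infty(1-e^{-sx})\overline\nu(s)\,ds$, with $\overline\nu$ a completely monotone Lévy density, such that $\lim_{\theta\to0}\varphi(\theta)=0$, $\lim_{\theta\to\infty}\varphi(\theta)=+\infty$, $\lim_{\theta\to0}\varphi(\theta)/\theta=+\infty$ and $\lim_{\theta\to\infty}\varphi(\theta)/\theta=0$. Let $\kappa$ be the function with Laplace transform $1/\varphi$ and $\chi(x)=\int_0^x\kappa(z)dz$. Assume that for every $\varepsilon>0$ one has $\kappa\in L^1(0,\varepsilon)\cap L^2(\varepsilon,\infty)$ and $\chi\in L^2(0,\varepsilon)$. Then the process $$B_t^\kappa=\sqrt{C_\kappa}\int_{\mathbb R}\big[\chi((t-u)_+)-\chi((-u)_+)\big]dW_u,\qquad t\ge0,$$ is persistent, i.e. $\rho_n:=\mathbb E\big[B_1^\kappa(B_{n+1}^\kappa-B_n^\kappa)\big]>0$ for all integers $n\ge1$.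
   Context: A Lévy density satisfies $\int_0^\infty(s\wedge1)\overline\nu(s)ds<\infty$. $\kappa:(0,\infty)\to[0,\infty)$ is the (locally integrable, non-increasing) function with $\int_0^\infty e^{-s\theta}\kappa(s)ds=1/\varphi(\theta)$ for $\theta>0$; it exists because $\varphi$ is complete Bernstein, and is the Sonine associate of $\nu(x)=\int_x^\infty\overline\nu(z)dz$. $\chi(x)=0$ for $x\le0$, $(x)_+=\max(x,0)$. $W=(W_u)_{u\in\mathbb R}$ is a two-sided Wiener process, and $C_\kappa=\big(\int_{\mathbb R}[\chi((1-u)_+)-\chi((-u)_+)]^2du\big)^{-1}$ is a normalising constant. Under the stated hypotheses the integrand is in $L^2(\mathbb R)$ for every $t\ge0$. *)

(* Defs.v *)
From HB Require Import structures.
From mathcomp Require Import all_boot all_order all_algebra.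
From mathcomp Require Import all_classical all_reals all_analysis.

Set Implicit Arguments.
Unset Strict Implicit.
Unset Printing Implicit Defensive.

Import Order.TTheory GRing.Theory Num.Theory.
Import numFieldNormedType.Exports.

Local Open Scope classical_set_scope.
Local Open Scope ring_scope.

(* Functions on (0, +oo) are total functions [R -> R]; their values at points
   [x <= 0] are never used. *)

Definition completely_monotone (R : realType) (f : R -> R) : Prop :=
  forall (n : nat) (x : R), 0 < x ->
    derivable (derive1n n f) x 1 /\ 0 <= (-1) ^+ n * derive1n n f x.

Definition levy_density (R : realType) (m : R -> R) : Prop :=
  [/\ measurable_fun (`]0, +oo[ : set R) m,
      (forall s, 0 < s -> 0 <= m s) &
      (\int[lebesgue_measure]_(s in `]0%R, +oo[) (Num.min s 1 * m s)%:E
        < +oo)%E].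

Definition bernstein_integral (R : realType) (m : R -> R) (x : R) : \bar R :=
  (\int[lebesgue_measure]_(s in `]0%R, +oo[) ((1 - expR (- (s * x))) * m s)%:E)%E.

(* Bernstein functions whose Levy measure has a completely monotone density,
   through the Levy-Khintchine representation. *)
Definition complete_bernstein (R : realType) (phi : R -> R) : Prop :=
  exists (a b : R) (m : R -> R),
    [/\ 0 <= a, 0 <= b, levy_density m, completely_monotone m &
        forall x, 0 < x -> (phi x)%:E = ((a + b * x)%:E + bernstein_integral m x)%E].

Definition laplace (R : realType) (f : R -> R) (theta : R) : \bar R :=
  (\int[lebesgue_measure]_(s in `]0%R, +oo[) (expR (- (s * theta)) * f s)%:E)%E.

Definition in_L1 (R : realType) (D : set R) (f : R -> R) : Prop :=
  lebesgue_measure.-integrable D (EFin \o f).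

Definition in_L2 (R : realType) (D : set R) (f : R -> R) : Prop :=
  measurable_fun D f /\
  (\int[lebesgue_measure]_(x in D) ((f x) ^+ 2)%:E < +oo)%E.

(* For [x <= 0] the domain of integration is empty, so [chi kappa x = 0]. *)
Definition chi (R : realType) (kappa : R -> R) (x : R) : R :=
  \int[lebesgue_measure]_(z in `]0, x[) kappa z.

Definition kernel_kappa (R : realType) (kappa : R -> R) (t u : R) : R :=
  chi kappa (Num.max (t - u) 0) - chi kappa (Num.max (- u) 0).

Definition C_kappa (R : realType) (kappa : R -> R) : R :=
  (\int[lebesgue_measure]_(u in [set: R]) (kernel_kappa kappa 1 u) ^+ 2)^-1.

(* The product rule for a subfamily is the case [A i = setT] off it. *)
Definition mutually_independent (d : measure_display) (T : measurableType d)
    (R : realType) (P : probability T R) (n : nat) (X : 'I_n -> T -> R) : Prop :=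
  forall A : 'I_n -> set R, (forall i, measurable (A i)) ->
    P [set w | forall i, A i (X i w)] = (\prod_(i < n) P (X i @^-1` A i))%E.

(* [normal_prob m s] is parametrised by the standard deviation [s], and is not
   a Gaussian law for [s = 0], whence [s < t]. *)
Definition two_sided_wiener (d : measure_display) (T : measurableType d)
    (R : realType) (P : probability T R) (W : R -> {RV P >-> R}) : Prop :=
  [/\ {ae P, forall w, W 0 w = 0},
      (forall (n : nat) (t : nat -> R), (forall i, t i <= t i.+1) ->
         mutually_independent P
           (fun (i : 'I_n) w => W (t i.+1) w - W (t i) w)),
      (forall s t : R, s < t -> forall A : set R, measurable A ->
         P ((fun w => W t w - W s w) @^-1` A) =
         normal_prob 0 (Num.sqrt (t - s)) A) &
      {ae P, forall w, continuous (fun t : R => W t w)}].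

(* The step function [height * 1_(left, right]]. *)
Record step (R : realType) := Step {
  step_height : R;
  step_left : R;
  step_right : R;
  step_le : step_left <= step_right }.

Definition step_fun (R : realType) (s : seq (step R)) (u : R) : R :=
  \sum_(p <- s) step_height p * \1_(`]step_left p, step_right p]) u.

Definition step_integral (R : realType) (T : Type) (W : R -> T -> R)
    (s : seq (step R)) (w : T) : R :=
  \sum_(p <- s) step_height p * (W (step_right p) w - W (step_left p) w).

(* [X] is (a version of) [\int_R f dW]: the value at [f] of the L2-continuous
   extension to [L2(R)] of the integral of step functions. *)
Definition is_wiener_integral (d : measure_display) (T : measurableType d)
    (R : realType) (P : probability T R) (W : R -> {RV P >-> R})
    (f : R -> R) (X : {RV P >-> R}) : Prop :=
  in_L2 [set: R] f /\
  exists s : nat -> seq (step R),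
    ((fun n => \int[lebesgue_measure]_(u in [set: R])
                 ((f u - step_fun (s n) u) ^+ 2)%:E) : nat -> \bar R)%E
       @ \oo --> (0%E : \bar R) /\
    ((fun n => 'E_P[fun w => ((X w - step_integral (fun t => W t) (s n) w) ^+ 2)%R])
       : nat -> \bar R)%E @ \oo --> (0%E : \bar R).

Definition is_B_kappa (d : measure_display) (T : measurableType d)
    (R : realType) (P : probability T R) (W : R -> {RV P >-> R})
    (kappa : R -> R) (B : R -> {RV P >-> R}) : Prop :=
  forall t, 0 <= t -> exists X : {RV P >-> R},
    is_wiener_integral W (kernel_kappa kappa t) X /\
    {ae P, forall w, B t w = Num.sqrt (C_kappa kappa) * X w}.

Definition rho (d : measure_display) (T : measurableType d)
    (R : realType) (P : probability T R) (B : R -> {RV P >-> R}) (n : nat) :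
    \bar R :=
  ('E_P[fun w => (B 1 w * (B n.+1%:R w - B n%:R w))%R])%E.

Definition persistent (d : measure_display) (T : measurableType d)
    (R : realType) (P : probability T R) (B : R -> {RV P >-> R}) : Prop :=
  forall n : nat, (1 <= n)%N -> (0 < rho B n)%E.

(* Main.v *)
(** The Wiener integral is an isometry, so [rho n] equals [C_kappa] times the
    inner product in [L2(R)] of [kernel_kappa 1] and
    [kernel_kappa (n+1) - kernel_kappa n].  When [kappa > 0], the function [chi]
    is strictly increasing, so both factors are nonnegative, and positive on
    [(0, 1)].  If the nonincreasing function [kappa] vanished somewhere, it
    would be integrable and its Laplace transform [1/phi] would be bounded near
    [0], contradicting [phi -> 0].

    For the isometry, step functions are themselves step integrals, of the
    deterministic family [t |-> 1_(-oo, t]], whose increments have the same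
    squared norms [|t - s|] as those of [W].  By polarization the squared norms
    determine all inner products of increments, so only the Gaussian second
    moment is needed; the general case follows by continuity of the inner
    product. *)

Require Import Defs.
From mathcomp Require Import all_boot all_order all_algebra.
From mathcomp Require Import all_classical all_reals all_analysis.
From mathcomp Require Import measurable_realfun ring.
Set Implicit Arguments.
Unset Strict Implicit.
Unset Printing Implicit Defensive.

Import Order.TTheory GRing.Theory Num.Theory.
Import numFieldNormedType.Exports.
Local Open Scope classical_set_scope.
Local Open Scope ring_scope.

Lemma Rintegral_gt0 d (T : measurableType d) (R : realType)
    (mu : {measure set T -> \bar R}) (D A : set T) (f : T -> R) :
  measurable D -> measurable A -> A `<=` D -> (0 < mu A)%E ->
  mu.-integrable D (EFin \o f) ->
  (forall x, D x -> 0 <= f x) -> (forall x, A x -> 0 < f x) ->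
  0 < \int[mu]_(x in D) f x.
Proof.
move=> mD mA AD muA_gt0 intf f_ge0 f_gt0.
rewrite lt_neqAle Rintegral_ge0// andbT eq_sym; apply/eqP => intf0.
have : (\int[mu]_(x in D) `|(f x)%:E| = 0)%E.
  rewrite -[RHS]/(0%R%:E) -intf0 fineK ?integrable_fin_num//.
  by apply: eq_integral => x /set_mem Dx; rewrite gee0_abs// lee_fin f_ge0.
move=> /(ae_eq_integral_abs mu mD (measurable_int _ intf))[N [mN N0 subN]].
suff AN : A `<=` N by move: muA_gt0; rewrite (subset_measure0 _ _ AN) ?ltxx.
move=> x Ax; apply: subN => /(_ (AD x Ax)) [fx0].
by have := f_gt0 x Ax; rewrite fx0 ltxx.
Qed.

Lemma ge0_integral_density d (T : measurableType d) (R : realType)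
    (nu : {finite_measure set T -> \bar R})
    (mu : {sigma_finite_measure set T -> \bar R}) (p f : T -> \bar R) :
  mu.-integrable [set: T] p ->
  (forall A, measurable A -> nu A = \int[mu]_(x in A) p x)%E ->
  measurable_fun [set: T] f -> (forall x, 0 <= f x)%E ->
  (\int[nu]_x f x = \int[mu]_x (f x * p x))%E.
Proof.
move=> intp nuE mf f0; have mp := measurable_int _ intp.
have nu_mu : nu `<< mu.
  apply/null_content_dominatesP => A mA muA0; rewrite nuE// null_set_integral//.
  exact: measurable_funTS.
rewrite -(Radon_Nikodym_SigmaFinite.change_of_variables nu_mu)//.
have intRN := Radon_Nikodym_SigmaFinite.f_integrable nu_mu.
have mRN := measurable_int _ intRN.
apply: ae_eq_integral => //; [exact: emeasurable_funM..|].
apply/ae_eqe_mul2l/integral_ae_eq => // A _ mA.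
by rewrite -Radon_Nikodym_SigmaFinite.f_integral// nuE.
Qed.

Lemma ge0_integral_law d d' (T : measurableType d) (T' : measurableType d')
    (R : realType) (mu : {measure set T -> \bar R})
    (nu : {measure set T' -> \bar R}) (X : T -> T') (f : T' -> \bar R) :
  measurable_fun [set: T] X ->
  (forall A, measurable A -> mu (X @^-1` A) = nu A) ->
  measurable_fun [set: T'] f -> (forall x, 0 <= f x)%E ->
  (\int[mu]_w f (X w) = \int[nu]_x f x)%E.
Proof.
move=> mX law mf f0; pose mfunX : {mfun T >-> T'} := mfun_Sub (mem_set mX).
transitivity (\int[pushforward mu mfunX]_x f x)%E.
  by rewrite ge0_integral_pushforward.
by apply: eq_measure_integral => A mA _; exact: law.
Qed.

Section L2.
Context d {T : measurableType d} {R : realType}.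
Variable mu : {measure set T -> \bar R}.
Implicit Types (f g h : T -> R) (a : R).
Local Notation L2 := (Lfun mu 2%:E).

Lemma Lfun2P f : f \in L2 <->
  measurable_fun [set: T] f /\ (\int[mu]_x ((f x) ^+ 2)%:E < +oo)%E.
Proof.
have sqrE : (\int[mu]_x ((f x) ^+ 2)%:E = \int[mu]_x (`|(f x)%:E| `^ 2))%E.
  apply: eq_integral => x _.
  by rewrite poweR_EFin powR_mulrn// real_normK ?num_real.
rewrite inE/= /Lfun; split=> [/andP[/[!inE]/= mf f_lty]|[mf f_lty]].
  split=> //; rewrite sqrE -powR_Lnorm//; exact: poweR_lty.
apply/andP; rewrite !inE/=; split => //.
by rewrite /finite_norm unlock poweR_lty// -sqrE.
Qed.

Lemma Lfun2B f g : f \in L2 -> g \in L2 -> f - g \in L2.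
Proof. by move=> *; rewrite rpredB ?lee1n. Qed.

Lemma Lfun2Z a f : f \in L2 -> a *: f \in L2.
Proof. by move=> *; rewrite rpredZ ?lee1n. Qed.

Definition L2_inner f g : R := \int[mu]_x (f x * g x).

Lemma integrableM_Lfun2 f g : f \in L2 -> g \in L2 ->
  mu.-integrable [set: T] (EFin \o (f \* g)).
Proof. by move=> f2 g2; apply/Lfun1_integrable/Lfun2_mul_Lfun1. Qed.

Lemma L2_innerC f g : L2_inner f g = L2_inner g f.
Proof. by apply: eq_Rintegral => x _; rewrite mulrC. Qed.

Lemma L2_inner_ge0 f : 0 <= L2_inner f f.
Proof. by apply: Rintegral_ge0 => x _; rewrite -expr2 sqr_ge0. Qed.

Lemma L2_inner0l h : L2_inner 0 h = 0.
Proof.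
rewrite /L2_inner /Rintegral; under eq_integral do rewrite mul0r.
by rewrite integral0.
Qed.

Lemma L2_innerDl f g h : f \in L2 -> g \in L2 -> h \in L2 ->
  L2_inner (f + g) h = L2_inner f h + L2_inner g h.
Proof.
move=> f2 g2 h2; rewrite /L2_inner -RintegralD//; try exact: integrableM_Lfun2.
by apply: eq_Rintegral => x _; rewrite mulrDl.
Qed.

Lemma L2_innerZl a f h : f \in L2 -> h \in L2 ->
  L2_inner (a *: f) h = a * L2_inner f h.
Proof.
move=> f2 h2; rewrite /L2_inner -RintegralZl//; last exact: integrableM_Lfun2.
by apply: eq_Rintegral => x _; rewrite mulrA.
Qed.

Lemma L2_innerBl f g h : f \in L2 -> g \in L2 -> h \in L2 ->
  L2_inner (f - g) h = L2_inner f h - L2_inner g h.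
Proof.
move=> f2 g2 h2; rewrite -scaleN1r L2_innerDl ?Lfun2Z//.
by rewrite L2_innerZl// mulN1r.
Qed.

Lemma L2_innerBr f g h : f \in L2 -> g \in L2 -> h \in L2 ->
  L2_inner h (f - g) = L2_inner h f - L2_inner h g.
Proof. by move=> *; rewrite L2_innerC L2_innerBl// !(L2_innerC h). Qed.

Lemma L2_inner_suml (I : Type) (s : seq I) (F : I -> T -> R) h :
  (forall i, F i \in L2) -> h \in L2 ->
  L2_inner (\sum_(i <- s) F i) h = \sum_(i <- s) L2_inner (F i) h.
Proof.
move=> F2 h2; elim: s => [|i s IHs]; first by rewrite !big_nil L2_inner0l.
by rewrite !big_cons L2_innerDl ?IHs// rpred_sum ?lee1n.
Qed.

Lemma L2_inner_sumr (I : Type) (s : seq I) (F : I -> T -> R) h :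
  (forall i, F i \in L2) -> h \in L2 ->
  L2_inner h (\sum_(i <- s) F i) = \sum_(i <- s) L2_inner h (F i).
Proof.
move=> F2 h2; rewrite L2_innerC L2_inner_suml//.
by apply: eq_bigr => i _; rewrite L2_innerC.
Qed.

Lemma L2_inner_polarization f g : f \in L2 -> g \in L2 ->
  L2_inner f g =
  (L2_inner f f + L2_inner g g - L2_inner (f - g) (f - g)) / 2.
Proof.
move=> f2 g2; have fg2 := Lfun2B f2 g2.
by rewrite L2_innerBl// !L2_innerBr// (L2_innerC g f); field.
Qed.

Lemma Lnorm2E f : f \in L2 ->
  ('N[mu]_2%:E[EFin \o f])%E = (Num.sqrt (L2_inner f f))%:E.
Proof.
move=> f2; rewrite -powR12_sqrt ?L2_inner_ge0// -poweR_EFin.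
rewrite fineK ?integrable_fin_num ?integrableM_Lfun2//.
rewrite unlock; congr poweR; apply: eq_integral => x _ /=.
by rewrite powR_mulrn// real_normK ?num_real.
Qed.

Lemma L2_Cauchy_Schwarz f g : f \in L2 -> g \in L2 ->
  `|L2_inner f g| <= Num.sqrt (L2_inner f f) * Num.sqrt (L2_inner g g).
Proof.
move=> f2 g2; have [mf _] := (Lfun2P f).1 f2; have [mg _] := (Lfun2P g).1 g2.
rewrite -lee_fin EFinM -!Lnorm2E//.
apply: le_trans (hoelder mu mf mg _ _ _) => //; last first.
  by rewrite [RHS]splitr !div1r.
rewrite EFin_normr_Rintegral ?integrableM_Lfun2// Lnorm1.
apply: le_abse_integral => //.
exact: measurable_int (integrableM_Lfun2 f2 g2).
Qed.

Lemma cvg_L2_inner0 (h k : nat -> T -> R) (c : R) :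
  (forall n, h n \in L2) -> (forall n, k n \in L2) ->
  L2_inner (h n) (h n) @[n --> \oo] --> 0 ->
  L2_inner (k n) (k n) @[n --> \oo] --> c ->
  L2_inner (h n) (k n) @[n --> \oo] --> 0.
Proof.
move=> h2 k2 h0 kc; apply: norm_cvg0.
have cvg_norm u l : u n @[n --> \oo] --> (l : R) ->
    Num.sqrt (u n) @[n --> \oo] --> Num.sqrt l.
  by move=> ul; apply: continuous_cvg => //; exact: sqrt_continuous.
have hk0 : Num.sqrt (L2_inner (h n) (h n)) * Num.sqrt (L2_inner (k n) (k n))
    @[n --> \oo] --> 0.
  by rewrite -(mul0r (Num.sqrt c)) -sqrtr0; apply: cvgM; exact: cvg_norm.
apply: (squeeze_cvgr _ (cvg_cst 0) hk0).
by near=> n; rewrite normr_ge0/= L2_Cauchy_Schwarz.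
Unshelve. all: by end_near. Qed.

Lemma cvg_L2_inner f g (f_ g_ : nat -> T -> R) :
  f \in L2 -> g \in L2 -> (forall n, f_ n \in L2) -> (forall n, g_ n \in L2) ->
  L2_inner (f - f_ n) (f - f_ n) @[n --> \oo] --> 0 ->
  L2_inner (g - g_ n) (g - g_ n) @[n --> \oo] --> 0 ->
  L2_inner (f_ n) (g_ n) @[n --> \oo] --> L2_inner f g.
Proof.
move=> f2 g2 f_2 g_2 cf cg.
have df2 n := Lfun2B f2 (f_2 n); have dg2 n := Lfun2B g2 (g_2 n).
have expand n : L2_inner (f_ n) (g_ n) = L2_inner f g - L2_inner (f - f_ n) g
    - L2_inner (g - g_ n) f + L2_inner (f - f_ n) (g - g_ n).
  rewrite (L2_innerBl _ _ (dg2 n))// !L2_innerBl// !L2_innerBr//.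
  by rewrite (L2_innerC g f) (L2_innerC (g_ n) f); ring.
rewrite (funext expand) -[X in _ --> X]addr0; apply: cvgD; last first.
  exact: cvg_L2_inner0 cf cg.
rewrite -[X in _ --> X]subr0; apply: cvgB; last first.
  exact: (@cvg_L2_inner0 _ (fun=> f) _ dg2 (fun=> f2) cg (cvg_cst _)).
rewrite -[X in _ --> X]subr0; apply: cvgB; first exact: cvg_cst.
exact: (@cvg_L2_inner0 _ (fun=> g) _ df2 (fun=> g2) cf (cvg_cst _)).
Qed.

Lemma ae_eq_L2_inner (f f' g g' : T -> R) :
  f \in L2 -> g \in L2 -> f' \in L2 -> g' \in L2 ->
  {ae mu, forall x, f x = f' x} -> {ae mu, forall x, g x = g' x} ->
  L2_inner f g = L2_inner f' g'.
Proof.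
move=> f2 g2 f'2 g'2 ff' gg'; congr fine; apply: ae_eq_integral => //.
- exact: measurable_int (integrableM_Lfun2 f2 g2).
- exact: measurable_int (integrableM_Lfun2 f'2 g'2).
- by apply: filterS2 ff' gg' => x -> ->.
Qed.

Lemma ae_eq_Lfun2 f g : measurable_fun [set: T] f ->
  {ae mu, forall x, f x = g x} -> g \in L2 -> f \in L2.
Proof.
move=> mf fg /Lfun2P[mg g_lty]; apply/Lfun2P; split => //.
rewrite (ae_eq_integral (fun x => ((g x) ^+ 2)%:E))//.
- exact/measurable_EFinP/measurable_funX.
- exact/measurable_EFinP/measurable_funX.
- by apply: filterS fg => x ->.
Qed.

End L2.

Section normal_variance.
Context {R : realType}.
Local Notation mu := (@lebesgue_measure R).
Implicit Types m s x b : R.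

Lemma is_derive_normal_pdf m s x : s != 0 ->
  is_derive x 1 (normal_pdf m s) (- ((x - m) / s ^+ 2) * normal_pdf m s x).
Proof.
move=> s0; rewrite normal_pdfE// /normal_fun.
apply: is_derive_eq; rewrite /GRing.scale/=.
by field; rewrite s0.
Qed.

Lemma cvg_mul_normal_pdf0 s : s != 0 ->
  x * normal_pdf 0 s x @[x --> +oo] --> (0 : R).
Proof.
move=> s0; have s2 : 0 < s ^+ 2 *+ 2 by rewrite pmulrn_lgt0// exprn_even_gt0.
pose C := normal_peak s * (s ^+ 2 *+ 2).
have C0 : C * x^-1 @[x --> +oo] --> (0 : R).
  rewrite -(mulr0 C); apply: cvgM; first exact: cvg_cst.
  by apply/(@gtr0_cvgV0 _ _ _ _ id); [exact: nbhs_pinfty_gt|exact: cvg_id].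
apply: (squeeze_cvgr _ (cvg_cst 0) C0); near=> x.
have x0 : 0 < x by [].
rewrite mulr_ge0 ?(ltW x0) ?normal_pdf_ge0//= normal_pdfE// /normal_fun subr0.
rewrite mulrCA -[leRHS]mulrA ler_pM2l ?normal_peak_gt0// mulNr expRN.
rewrite ler_pdivrMr ?expR_gt0// mulrAC ler_pdivlMr// -expr2.
by rewrite mulrC -ler_pdivrMr// (le_trans _ (expR_ge1Dx _))// lerDr.
Unshelve. all: by end_near. Qed.

Lemma integral_sqr_normal_pdf0_itv s b : s != 0 -> 0 < b ->
  (\int[mu]_(x in `[0%R, b]) (x ^+ 2 * normal_pdf 0 s x)%:E =
   (- (s ^+ 2 * (b * normal_pdf 0 s b)))%:E +
   (s ^+ 2)%:E * \int[mu]_(x in `[0%R, b]) (normal_pdf 0 s x)%:E)%E.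
Proof.
move=> s0 b0; set p := normal_pdf 0 s.
have dp x : is_derive x 1 p (- (x / s ^+ 2) * p x).
  by rewrite -[X in X / _]subr0; exact: is_derive_normal_pdf.
have cp : continuous p by exact: continuous_normal_pdf.
have cZ a : continuous (fun x : R => a * x) by exact: mulrl_continuous.
rewrite (_ : (fun x => (x ^+ 2 * p x)%:E) = (fun x =>
    ((- s ^+ 2 * x) * (- (x / s ^+ 2) * p x))%:E)); last first.
  by apply/funext => x; congr EFin; field.
rewrite (@integration_by_parts _ (fun x => - s ^+ 2 * x) p (fun=> - s ^+ 2)
  (fun x => - (x / s ^+ 2) * p x))//.
- rewrite mulr0 mul0r subr0 -mulrA mulNr; congr (_ + _)%E.
  under eq_integral do rewrite EFinM.
  rewrite integralZl//= ?EFinN ?mulNe ?oppeK//.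
  apply: continuous_compact_integrable; first exact: segment_compact.
  exact: continuous_subspaceT cp.
- by apply: continuous_subspaceT => x; exact: cvg_cst.
- split; [by move=> x _; exact: ex_derive|exact/cvg_at_right_filter/cZ|].
  exact/cvg_at_left_filter/cZ.
- by move=> x _; rewrite derive1E derive_val /GRing.scale/= mulr1.
- apply: continuous_subspaceT => x; apply: cvgM; last exact: cp.
  by apply: cvgN; exact: mulrr_continuous.
- split; [by move=> x _; have [] := dp x|exact/cvg_at_right_filter/cp|].
  exact/cvg_at_left_filter/cp.
- by move=> x _; rewrite derive1E; have [] := dp x.
Qed.

Lemma integral_sqr_normal_pdf0y s : s != 0 ->
  (\int[mu]_(x in `[0%R, +oo[) (x ^+ 2 * normal_pdf 0 s x)%:E =
   (s ^+ 2)%:E * \int[mu]_(x in `[0%R, +oo[) (normal_pdf 0 s x)%:E)%E.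
Proof.
move=> s0.
have p0 x : 0 <= normal_pdf 0 s x by exact: normal_pdf_ge0.
have mp : measurable_fun setT (normal_pdf 0 s) by exact: measurable_normal_pdf.
have cvg_pdf := ge0_cvgn_integral (mu := mu) p0 mp.
have cvg_sqr_pdf := ge0_cvgn_integral (mu := mu)
  (fun x => mulr_ge0 (sqr_ge0 x) (p0 x))
  (measurable_funM (exprn_measurable 2) mp).
rewrite -cvg_shiftS/= in cvg_pdf; rewrite -cvg_shiftS/= in cvg_sqr_pdf.
apply: (cvg_unique _ cvg_sqr_pdf) => //.
rewrite (funext (fun n => integral_sqr_normal_pdf0_itv s0 (ltr0Sn R n))).
have boundary : - (s ^+ 2 * (n.+1%:R * normal_pdf 0 s n.+1%:R)) @[n --> \oo]
    --> - (s ^+ 2 * 0).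
  apply: cvgN; apply: cvgM; first exact: cvg_cst.
  have := cvg_comp _ _ (@cvgr_idn R) (cvg_mul_normal_pdf0 s0).
  by rewrite /comp -cvg_shiftS.
rewrite mulr0 oppr0 in boundary.
rewrite -[((s ^+ 2)%:E * \int[mu]_(x in `[0%R, +oo[) _)%E]add0e.
apply: cvgeD => //; last exact: cvgeZl.
by apply: cvg_EFin boundary; near=> n.
Unshelve. all: by end_near. Qed.

Lemma integral_sqr_normal_pdf0 s : s != 0 ->
  (\int[mu]_x (x ^+ 2 * normal_pdf 0 s x)%:E = (s ^+ 2)%:E)%E.
Proof.
move=> s0; set p := normal_pdf 0 s.
have p0 x : 0 <= p x by exact: normal_pdf_ge0.
have cp : continuous p by exact: continuous_normal_pdf.
have p_even : p =1 p \o -%R.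
  by move=> x /=; rewrite /p normal_pdfE// /normal_fun !subr0 sqrrN.
have := @integral_normal_pdf R 0 s.
rewrite !ge0_symfun_integralT//; first last.
- by move=> x /=; rewrite sqrrN p_even.
- by move=> x; apply: cvgM; [exact: sqr_continuous|exact: cp].
- by move=> x; rewrite mulr_ge0 ?sqr_ge0.
by rewrite -set_itvcy integral_sqr_normal_pdf0y// muleCA => ->; rewrite mule1.
Qed.

Lemma ge0_integral_addr (g : R -> R) m : continuous g -> (forall x, 0 <= g x) ->
  (\int[mu]_x (g x)%:E = \int[mu]_x (g (x + m))%:E)%E.
Proof.
move=> cg g0; have shift'1 : derive1 (fun x : R => x + m) = cst 1.
  by apply/funext => x; rewrite derive1E derive_val addr0.
rewrite (increasing_ge0_integration_by_substitutionT (F := fun x => x + m))//.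
- by apply: eq_integral => x _; rewrite shift'1 /= mulr1.
- by move=> x y; rewrite ltrD2r.
- by rewrite shift'1; exact: cst_continuous.
- by rewrite shift'1; exact: is_cvg_cst.
- by rewrite shift'1; exact: is_cvg_cst.
- exact: cvg_addrr_Ny.
- exact: cvg_addrr.
Qed.

Lemma normal_prob_variance m s : s != 0 ->
  (\int[normal_prob m s]_x ((x - m) ^+ 2)%:E = (s ^+ 2)%:E)%E.
Proof.
move=> s0; rewrite (ge0_integral_density (integrable_normal_pdf m s))//;
  last 2 first.
- apply/measurable_EFinP/measurable_funX; exact: measurable_funB.
- by move=> x; rewrite lee_fin sqr_ge0.
under eq_integral do rewrite -EFinM.
rewrite (ge0_integral_addr m).
- under eq_integral do rewrite addrK.
  rewrite -(integral_sqr_normal_pdf0 s0); apply: eq_integral => x _.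
  by rewrite !normal_pdfE// (normal_fun_center m)/= addrK.
- move=> x; apply: cvgM; last exact: continuous_normal_pdf.
  apply: (cvg_comp (fun x => x - m) (fun x => x ^+ 2)).
    by apply: cvgB; [exact: cvg_id|exact: cvg_cst].
  exact: sqr_continuous.
- by move=> x; rewrite mulr_ge0 ?sqr_ge0 ?normal_pdf_ge0.
Qed.

End normal_variance.

Section step_integral.
Context d {T : measurableType d} {R : realType}.
Variables (mu : {measure set T -> \bar R}) (F : R -> T -> R).
Implicit Types (a b c e s t : R) (l : seq (step R)).
Local Notation L2 := (Lfun mu 2%:E).

Definition variogram s t : \bar R := (\int[mu]_x ((F t x - F s x) ^+ 2)%:E)%E.

Lemma variogramC s t : variogram s t = variogram t s.
Proof. by apply: eq_integral => x _; rewrite -sqrrN opprB. Qed.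

Lemma variogram_distE :
  (forall s t, s < t -> variogram s t = (t - s)%:E) ->
  forall s t, variogram s t = `|t - s|%:E.
Proof.
move=> F_lt s t; have [st|ts|->] := ltgtP s t.
- by rewrite F_lt// gtr0_norm ?subr_gt0.
- by rewrite variogramC F_lt// distrC gtr0_norm ?subr_gt0.
- rewrite /variogram; under eq_integral do rewrite subrr expr0n.
  by rewrite integral0 subrr normr0.
Qed.

Hypothesis measurable_F : forall t, measurable_fun [set: T] (F t).
Hypothesis variogram_lty : forall s t, (variogram s t < +oo)%E.

Lemma Lfun2_increment s t : F t - F s \in L2.
Proof.
by apply/Lfun2P; split; [exact: measurable_funB|exact: variogram_lty].
Qed.

Lemma L2_inner_increments a b c e : L2_inner mu (F b - F a) (F e - F c) =
  (fine (variogram c b) + fine (variogram a e) - fine (variogram e b)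
   - fine (variogram a c)) / 2.
Proof.
have L2_normE s t : L2_inner mu (F t - F s) (F t - F s) = fine (variogram s t).
  by [].
have diff_a s t : F t - F s = (F t - F a) - (F s - F a).
  by rewrite opprB addrA subrK.
rewrite [F e - F c]diff_a L2_innerBr; [|exact: Lfun2_increment..].
have polarization t := L2_inner_polarization (Lfun2_increment a b)
  (Lfun2_increment a t).
by rewrite (polarization e) (polarization c) -!diff_a !L2_normE; field.
Qed.

Lemma step_integralE l : step_integral F l =
  \sum_(p <- l) step_height p *: (F (step_right p) - F (step_left p)).
Proof. by apply/funext => x; rewrite fct_sumE. Qed.

Lemma Lfun2_step_integral l : step_integral F l \in L2.
Proof.
rewrite step_integralE rpred_sum ?lee1n// => ? p _.
exact/Lfun2Z/Lfun2_increment.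
Qed.

Lemma L2_inner_step_integral l l' :
  L2_inner mu (step_integral F l) (step_integral F l') =
  \sum_(p <- l) \sum_(q <- l') step_height p * (step_height q *
    L2_inner mu (F (step_right p) - F (step_left p))
                (F (step_right q) - F (step_left q))).
Proof.
have F2 := Lfun2_increment.
have FZ a s t : a *: (F t - F s) \in L2 by exact: Lfun2Z.
rewrite (step_integralE l) L2_inner_suml ?Lfun2_step_integral//.
apply: eq_bigr => p _; rewrite step_integralE L2_inner_sumr//.
apply: eq_bigr => q _; rewrite L2_innerZl// L2_innerC L2_innerZl//.
by rewrite L2_innerC.
Qed.

End step_integral.

Lemma step_integral_isometry d d' (T : measurableType d)
    (T' : measurableType d') (R : realType) (mu : {measure set T -> \bar R})
    (nu : {measure set T' -> \bar R}) (F : R -> T -> R) (G : R -> T' -> R)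
    (l l' : seq (step R)) :
  (forall t, measurable_fun [set: T] (F t)) ->
  (forall t, measurable_fun [set: T'] (G t)) ->
  (forall s t, variogram mu F s t < +oo)%E ->
  variogram mu F =2 variogram nu G ->
  L2_inner mu (step_integral F l) (step_integral F l') =
  L2_inner nu (step_integral G l) (step_integral G l').
Proof.
move=> mF mG F_lty FG.
have G_lty s t : (variogram nu G s t < +oo)%E by rewrite -FG.
rewrite !L2_inner_step_integral//; apply: eq_bigr => p _; apply: eq_bigr => q _.
by rewrite !L2_inner_increments// !FG.
Qed.

Section half_line.
Context {R : realType}.
Local Notation lambda := (@lebesgue_measure R).
Implicit Types s t : R.

Definition half_line t : R -> R := \1_(`]-oo, t]).

Lemma measurable_half_line t : measurable_fun [set: R] (half_line t).
Proof. exact: measurable_indic. Qed.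

Lemma half_lineB s t u : s <= t ->
  half_line t u - half_line s u = \1_(`]s, t]) u.
Proof.
move=> st; rewrite /half_line !indicE !mem_setE !in_itv/=.
have [us|su] := leP u s; last by rewrite subr0.
by rewrite (le_trans us st) subrr.
Qed.

Lemma step_fun_half_line (l : seq (step R)) :
  step_fun l = step_integral half_line l.
Proof.
by apply/funext => u; apply: eq_bigr => p _; rewrite half_lineB ?step_le.
Qed.

Lemma variogram_half_line s t : variogram lambda half_line s t = `|t - s|%:E.
Proof.
apply: variogram_distE => {}s {}t st.
transitivity (\int[lambda]_u (\1_(`]s, t]) u)%:E)%E.
  apply: eq_integral => u _; rewrite half_lineB ?ltW//.
  by rewrite indicE expr2 -natrM mulnb andbb.
by rewrite integral_indic// setIT/= lebesgue_measure_itv/= lte_fin st.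
Qed.

Lemma Lfun2_step_fun (l : seq (step R)) : step_fun l \in Lfun lambda 2%:E.
Proof.
rewrite step_fun_half_line; apply: Lfun2_step_integral => [t|s t].
  exact: measurable_half_line.
by rewrite variogram_half_line ltry.
Qed.

End half_line.

Section wiener_integral.
Context d {T : measurableType d} {R : realType}.
Variables (P : probability T R) (W : R -> {RV P >-> R}).
Hypothesis wiener_W : two_sided_wiener W.
Local Notation lambda := (@lebesgue_measure R).
Local Notation path := (fun t => W t : T -> R).
Implicit Types s t : R.

Lemma variogram_wiener s t : variogram P path s t = `|t - s|%:E.
Proof.
apply: variogram_distE => {}s {}t st; have [_ _ /(_ s t st) law _] := wiener_W.
have ts0 : 0 < t - s by rewrite subr_gt0.
rewrite -[t - s]sqr_sqrtr ?ltW// -(normal_prob_variance 0) ?gt_eqF ?sqrtr_gt0//.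
under [RHS]eq_integral do rewrite subr0.
apply: (ge0_integral_law (nu := normal_prob 0 (Num.sqrt (t - s)))
  (X := fun w => W t w - W s w) (f := fun x => (x ^+ 2)%:E)) => //.
- exact: measurable_funB.
- exact/measurable_EFinP/measurable_funX.
- by move=> x; rewrite lee_fin sqr_ge0.
Qed.

Lemma Lfun2_wiener_step_integral l : step_integral path l \in Lfun P 2%:E.
Proof.
by apply: Lfun2_step_integral => // s t; rewrite variogram_wiener ltry.
Qed.

Lemma L2_inner_wiener_step_integral l l' :
  L2_inner P (step_integral path l) (step_integral path l') =
  L2_inner lambda (step_fun l) (step_fun l').
Proof.
rewrite !step_fun_half_line; apply: step_integral_isometry => //.
- exact: measurable_half_line.
- by move=> s t; rewrite variogram_wiener ltry.
- by move=> s t; rewrite variogram_wiener variogram_half_line.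
Qed.

Lemma Lfun2_wiener_integral (f : R -> R) (X : {RV P >-> R}) :
  is_wiener_integral W f X -> (X : T -> R) \in Lfun P 2%:E.
Proof.
move=> [_ [l [_]]]; rewrite unlock => /fine_cvgP[[N _ fin] _].
have I2 := Lfun2_wiener_step_integral (l N).
suff XI2 : (X : T -> R) - step_integral path (l N) \in Lfun P 2%:E.
  by rewrite -[X : T -> R](subrK (step_integral path (l N))) rpredD ?lee1n.
apply/Lfun2P; split.
  by apply: measurable_funB => //; have /Lfun2P[] := I2.
rewrite -ge0_fin_numE; first exact: fin N (leqnn N).
by apply: integral_ge0 => w _; rewrite lee_fin sqr_ge0.
Qed.

Lemma Lfun2_wiener_integrand (f : R -> R) (X : {RV P >-> R}) :
  is_wiener_integral W f X -> f \in Lfun lambda 2%:E.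
Proof. by move=> [f2 _]; exact/Lfun2P. Qed.

Lemma wiener_integral_L2_approx (f : R -> R) (X : {RV P >-> R}) :
  is_wiener_integral W f X -> exists l : nat -> seq (step R),
    L2_inner lambda (f - step_fun (l n)) (f - step_fun (l n))
      @[n --> \oo] --> 0 /\
    L2_inner P ((X : T -> R) - step_integral path (l n))
      ((X : T -> R) - step_integral path (l n)) @[n --> \oo] --> 0.
Proof.
move=> [_ [l [fl Xl]]]; exists l; rewrite unlock in Xl.
by split; [exact: fine_cvg fl|exact: fine_cvg Xl].
Qed.

Lemma wiener_isometry (f g : R -> R) (X Y : {RV P >-> R}) :
  is_wiener_integral W f X -> is_wiener_integral W g Y ->
  L2_inner P X Y = L2_inner lambda f g.
Proof.
move=> fX gY; have [l [fl Xl]] := wiener_integral_L2_approx fX.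
have [l' [gl' Yl']] := wiener_integral_L2_approx gY.
have cvgXY := cvg_L2_inner (Lfun2_wiener_integral fX) (Lfun2_wiener_integral gY)
  (fun n => Lfun2_wiener_step_integral (l n))
  (fun n => Lfun2_wiener_step_integral (l' n)) Xl Yl'.
have cvgfg := cvg_L2_inner (Lfun2_wiener_integrand fX)
  (Lfun2_wiener_integrand gY) (fun n => Lfun2_step_fun (l n))
  (fun n => Lfun2_step_fun (l' n)) fl gl'.
rewrite (funext (fun n => L2_inner_wiener_step_integral (l n) (l' n))) in cvgXY.
exact: cvg_unique cvgXY cvgfg.
Qed.

End wiener_integral.

Section laplace_positivity.
Context {R : realType}.
Local Notation lambda := (@lebesgue_measure R).
Variable f : R -> R.
Hypothesis f_ge0 : forall x, 0 < x -> 0 <= f x.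
Hypothesis f_L1 : forall eps, 0 < eps -> in_L1 `]0, eps[ f.

Lemma laplace_le_chi x theta : 0 < x -> 0 <= theta ->
  (forall y, x <= y -> f y = 0) -> (laplace f theta <= (chi f x)%:E)%E.
Proof.
move=> x0 theta0 f_eq0; have /integrableP[mf _] := f_L1 x0.
have laplaceE : laplace f theta =
    (\int[lambda]_(s in `]0%R, x[) (expR (- (s * theta)) * f s)%:E)%E.
  rewrite /laplace integral_mkcond [RHS]integral_mkcond.
  apply: eq_integral => s _; rewrite !patchE !mem_setE !in_itv/= andbT.
  by case: (ltP 0 s) => //= s0; case: ltP => // xs; rewrite f_eq0// mulr0.
rewrite laplaceE fineK; last exact: integrable_fin_num (f_L1 x0).
apply: ge0_le_integral => //=.
- move=> s; rewrite in_itv/= => /andP[s0 _].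
  by rewrite lee_fin mulr_ge0 ?expR_ge0 ?f_ge0.
- apply/measurable_EFinP/measurable_funM; last exact/measurable_EFinP.
  apply: measurable_funTS; apply: measurableT_comp => //.
  by apply: measurableT_comp => //; exact: measurable_funM.
- move=> s; rewrite in_itv/= => /andP[s0 _].
  by rewrite lee_fin ler_piMl ?f_ge0// -expR0 ler_expR oppr_le0 mulr_ge0// ltW.
Qed.

Lemma noninc_laplace_cvgy_gt0 :
  (forall x y, 0 < x -> x <= y -> f y <= f x) ->
  laplace f theta @[theta --> 0^'+] --> +oo%E ->
  forall x, 0 < x -> 0 < f x.
Proof.
move=> f_noninc laplace_oo x x0.
rewrite lt_neqAle f_ge0// andbT; apply/eqP => fx0.
have f_eq0 y : x <= y -> f y = 0.
  move=> xy; apply/eqP; rewrite eq_le f_ge0 ?(lt_le_trans x0)// andbT.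
  by rewrite [leRHS]fx0 f_noninc.
near (0 : R)^'+ => theta; have theta0 : 0 < theta by [].
have := laplace_le_chi x0 (ltW theta0) f_eq0; apply/negP; rewrite -ltNge.
by near: theta; exact: (cvgeyPgt _).1.
Unshelve. all: by end_near. Qed.

End laplace_positivity.

Lemma cvgy_div_near_gt0 (R : realType) (phi : R -> R) :
  phi theta / theta @[theta --> 0^'+] --> +oo ->
  \forall theta \near 0^'+, 0 < phi theta.
Proof.
move=> phi_div_oo; near=> theta; have theta0 : 0 < theta by [].
rewrite -(pmulr_lgt0 _ (x := theta^-1)) ?invr_gt0//.
by near: theta; exact: (cvgryPgt _).1.
Unshelve. all: by end_near. Qed.

Lemma lebesgue_measure_itvoo_gt0 (R : realType) (a b : R) : a < b ->
  (0 < (@lebesgue_measure R) `]a, b[)%E.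
Proof.
by move=> ab; rewrite lebesgue_measure_itv/= lte_fin ab lte_fin subr_gt0.
Qed.

Section sonine_kernel.
Context {R : realType}.
Variable kappa : R -> R.
Local Notation lambda := (@lebesgue_measure R).
Hypothesis kappa_gt0 : forall x : R, 0 < x -> 0 < kappa x.
Hypothesis kappa_L1 : forall eps : R, 0 < eps -> in_L1 `]0, eps[ kappa.
Implicit Types s t u x y : R.

Lemma chi_lt x y : 0 <= x -> x < y -> chi kappa x < chi kappa y.
Proof.
move=> x0 xy; have Iy : lambda.-integrable `]0, y[ (EFin \o kappa).
  exact: kappa_L1 (le_lt_trans x0 xy).
have Ix : lambda.-integrable `]0, x[ (EFin \o kappa).
  by apply: integrableS Iy => //; apply: subset_itvl; rewrite bnd_simp ltW.
rewrite -subr_gt0 /chi (Rintegral_itv_bndo_bndc Ix) Rintegral_itvB//.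
have xy_gt0 z : `]x, y[%classic z -> 0 < kappa z.
  by rewrite /= in_itv/= => /andP[xz _]; apply: kappa_gt0 (le_lt_trans x0 xz).
apply: (Rintegral_gt0 (mu := lambda) (A := `]x, y[)) => //.
- exact: lebesgue_measure_itvoo_gt0.
- by apply: integrableS Iy => //; apply: subset_itvr; rewrite bnd_simp.
- by move=> z /xy_gt0/ltW.
Qed.

Lemma kernel_kappa_lt s t u : s < t -> u < t ->
  kernel_kappa kappa s u < kernel_kappa kappa t u.
Proof.
move=> st ut; rewrite /kernel_kappa ltrD2r chi_lt ?le_max ?lexx ?orbT//.
by rewrite lt_max !gt_max ltrD2r st subr_gt0 ut.
Qed.

Lemma kernel_kappa_le s t u : s <= t ->
  kernel_kappa kappa s u <= kernel_kappa kappa t u.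
Proof.
rewrite le_eqVlt => /predU1P[->//|st].
have [ut|tu] := ltP u t; first by rewrite ltW// kernel_kappa_lt.
rewrite /kernel_kappa [Num.max (s - u) 0]max_r ?subr_le0 ?(le_trans (ltW st))//.
by rewrite [Num.max (t - u) 0]max_r ?subr_le0.
Qed.

Lemma kernel_kappa0 u : kernel_kappa kappa 0 u = 0.
Proof. by rewrite /kernel_kappa sub0r subrr. Qed.

Lemma kernel_kappa_ge0 t u : 0 <= t -> 0 <= kernel_kappa kappa t u.
Proof. by move=> t0; rewrite -(kernel_kappa0 u) kernel_kappa_le. Qed.

Lemma kernel_kappa_gt0 t u : 0 < t -> u < t -> 0 < kernel_kappa kappa t u.
Proof. by move=> t0 ut; rewrite -(kernel_kappa0 u) kernel_kappa_lt. Qed.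

Hypothesis kernel_kappa_L2 : forall t,
  0 <= t -> kernel_kappa kappa t \in Lfun lambda 2%:E.

Lemma L2_inner_kernel_kappa_gt0 r s t : 0 < r -> 0 <= s -> s < t ->
  0 < L2_inner lambda (kernel_kappa kappa r)
        (kernel_kappa kappa t - kernel_kappa kappa s).
Proof.
move=> r0 s0 st; have t0 := le_lt_trans s0 st.
have Kr := kernel_kappa_L2 (ltW r0).
have Kst := Lfun2B (kernel_kappa_L2 (ltW t0)) (kernel_kappa_L2 s0).
have rt0 : 0 < Num.min r t by rewrite lt_min r0.
apply: (Rintegral_gt0 (mu := lambda) (A := `]0, Num.min r t[)) => //.
- exact: lebesgue_measure_itvoo_gt0.
- exact: integrableM_Lfun2 Kr Kst.
- move=> u _; apply: mulr_ge0; first exact: kernel_kappa_ge0 (ltW r0).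
  by rewrite !fctE subr_ge0 kernel_kappa_le// ltW.
- move=> u; rewrite /= in_itv/= lt_min => /and3P[_ ur ut].
  by rewrite mulr_gt0 ?kernel_kappa_gt0// !fctE subr_gt0 kernel_kappa_lt.
Qed.

Lemma C_kappa_gt0 : 0 < C_kappa kappa.
Proof.
have K1E : kernel_kappa kappa 1 - kernel_kappa kappa 0 = kernel_kappa kappa 1.
  by apply/funext => u; rewrite !fctE kernel_kappa0 subr0.
have := L2_inner_kernel_kappa_gt0 ltr01 (lexx 0) ltr01.
by rewrite K1E /C_kappa invr_gt0.
Qed.

End sonine_kernel.

Section B_kappa.
Context d {T : measurableType d} {R : realType}.
Variables (P : probability T R) (W : R -> {RV P >-> R}).
Hypothesis wiener_W : two_sided_wiener W.
Variables (kappa : R -> R) (B : R -> {RV P >-> R}).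
Hypothesis B_kappa : is_B_kappa W kappa B.
Local Notation lambda := (@lebesgue_measure R).
Implicit Types s t : R.

Lemma C_kappa_ge0 : 0 <= C_kappa kappa.
Proof. by rewrite invr_ge0 Rintegral_ge0// => u _; rewrite sqr_ge0. Qed.

Lemma Lfun2_kernel_kappa t : 0 <= t ->
  kernel_kappa kappa t \in Lfun lambda 2%:E.
Proof. by move=> /B_kappa[X [/Lfun2_wiener_integrand]]. Qed.

Lemma Lfun2_B_kappa t : 0 <= t -> (B t : T -> R) \in Lfun P 2%:E.
Proof.
move=> /B_kappa[X [/(Lfun2_wiener_integral wiener_W) X2 BX]].
apply: (ae_eq_Lfun2 _ BX); first by [].
exact: Lfun2Z.
Qed.

Lemma L2_inner_B_kappa s t : 0 <= s -> 0 <= t -> L2_inner P (B s) (B t) =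
  C_kappa kappa * L2_inner lambda (kernel_kappa kappa s) (kernel_kappa kappa t).
Proof.
move=> s0 t0; have Bs2 := Lfun2_B_kappa s0; have Bt2 := Lfun2_B_kappa t0.
have [X [WX BX]] := B_kappa s0; have [Y [WY BY]] := B_kappa t0.
have X2 := Lfun2_wiener_integral wiener_W WX.
have Y2 := Lfun2_wiener_integral wiener_W WY.
rewrite (ae_eq_L2_inner Bs2 Bt2 (Lfun2Z _ X2) (Lfun2Z _ Y2) BX BY).
rewrite L2_innerZl ?Lfun2Z// L2_innerC L2_innerZl// L2_innerC.
by rewrite (wiener_isometry wiener_W WX WY) mulrA -expr2 sqr_sqrtr ?C_kappa_ge0.
Qed.

Lemma rho_B_kappa (n : nat) : rho B n = (C_kappa kappa *
  L2_inner lambda (kernel_kappa kappa 1)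
    (kernel_kappa kappa n.+1%:R - kernel_kappa kappa n%:R))%:E.
Proof.
have B1 := Lfun2_B_kappa ler01; have K1 := Lfun2_kernel_kappa ler01.
have Bn := Lfun2_B_kappa (ler0n R n); have Kn := Lfun2_kernel_kappa (ler0n R n).
have BS := Lfun2_B_kappa (ler0n R n.+1).
have KS := Lfun2_kernel_kappa (ler0n R n.+1).
have -> : rho B n = (L2_inner P (B 1) ((B n.+1%:R : T -> R) - B n%:R))%:E.
  rewrite /rho unlock fineK//; apply: integrable_fin_num => //.
  exact: integrableM_Lfun2 B1 (Lfun2B BS Bn).
rewrite (L2_innerBr BS Bn B1) (L2_innerBr KS Kn K1) mulrBr.
by rewrite !L2_inner_B_kappa.
Qed.

End B_kappa.

Unset Implicit Arguments.

Theorem theorem5p2 (R : realType) (d : measure_display) (T : measurableType d)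
    (P : probability T R) (W : R -> {RV P >-> R}) (hW : two_sided_wiener W)
    (phi nu kappa : R -> R)
    (hnu : levy_density nu) (hnu_cm : completely_monotone nu)
    (hphi_cb : complete_bernstein phi)
    (hphi : forall x : R, 0 < x -> (phi x)%:E = bernstein_integral nu x)
    (hphi_0 : phi theta @[theta --> 0^'+] --> (0 : R))
    (hphi_oo : phi theta @[theta --> +oo] --> +oo)
    (hphi_div_0 : phi theta / theta @[theta --> 0^'+] --> +oo)
    (hphi_div_oo : phi theta / theta @[theta --> +oo] --> (0 : R))
    (hkappa_ge0 : forall x : R, 0 < x -> 0 <= kappa x)
    (hkappa_loc : locally_integrable `]0, +oo[ kappa)
    (hkappa_noninc : forall x y : R, 0 < x -> x <= y -> kappa y <= kappa x)
    (hkappa : forall theta : R, 0 < theta ->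
       laplace kappa theta = ((phi theta)^-1)%:E)
    (hkappa_L : forall eps : R, 0 < eps ->
       in_L1 `]0, eps[ kappa /\ in_L2 `]eps, +oo[ kappa)
    (hchi_L2 : forall eps : R, 0 < eps -> in_L2 `]0, eps[ (chi kappa))
    (B : R -> {RV P >-> R}) (hB : is_B_kappa W kappa B) :
  persistent B.
Proof.
have kappa_L1 (eps : R) : 0 < eps -> in_L1 `]0, eps[ kappa.
  by move=> /hkappa_L[].
have laplace_oo : laplace kappa theta @[theta --> 0^'+] --> +oo%E.
  have phi_gt0 := cvgy_div_near_gt0 hphi_div_0.
  apply: cvg_trans ((cvgeryP _).2 ((cvgrVy phi_gt0).2 hphi_0)).
  by apply: near_eq_cvg; near=> theta; rewrite /= hkappa.
have kappa_gt0 := noninc_laplace_cvgy_gt0 hkappa_ge0 kappa_L1 hkappa_noninc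
  laplace_oo.
have kernel_L2 := Lfun2_kernel_kappa hB.
move=> n _; rewrite (rho_B_kappa hW hB) lte_fin mulr_gt0//.
  exact: C_kappa_gt0.
by apply: L2_inner_kernel_kappa_gt0; rewrite ?ltr_nat.
Unshelve. all: by end_near. Qed.
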